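(* For every odd integer $m \ge 5$ the graph $G_m$ is Hamiltonian, and for every even integer $m \ge 6$ the graph $H_m$ is Hamiltonian.
   Context: All graphs are finite and simple. A graph is Hamiltonian if it has a cycle passing through every vertex exactly once. Let $m \ge 5$ be an integer and $n = 2m+1$. The graph $G_m$ is defined for $m$ odd and the graph $H_m$ for $m$ even. In both cases the vertex set consists of the $n$ distinct vertices $a_n$, $p_1,\dots,p_m$, $q_1,\dots,q_m$. All indices of $p$ and $q$ are taken modulo $m$ with representatives in $\{1,\dots,m\}$ (so $q_0 = q_m$, $p_{m+1}=p_1$, $q_{m+1} = q_1$, etc.). The (undirected) edges are: (1) $a_n q_i$ for $1 \le i \le m$; (2) $p_i p_{i+1}$ for $1 \le i \le m$; (3) for $G_m$ ($m$ odd): $p_i q_{i+(2k-1)}$ for $1 \le i \le m$ and all integers $k$ with $0 \le k \le \frac{m-3}{2}$; for $H_m$ ($m$ even): $p_i q_{i+(2k-1)}$ for $1 \le i \le m$ and all integers $k$ with $0 \le k \le \frac{m-2}{2}$. There are no other edges. *)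

(* Defs.v *)
From HB Require Import structures.
From mathcomp Require Import all_boot.

Set Implicit Arguments.
Unset Strict Implicit.
Unset Printing Implicit Defensive.

(* The size bound excludes the degenerate closed walks x and x, y, x, which
   [cycle] accepts. *)
Definition hamiltonian (T : finType) (e : rel T) : Prop :=
  exists c : seq T, [/\ 2 < size c, cycle e c, uniq c & forall x, x \in c].

(* Indices modulo m are represented by 0, ..., m-1, so that p_m and q_m are
   [P 0] and [Q 0]; the apex [A] is the vertex a_n with n = 2m+1. *)
Variant vertex (m : nat) : Type :=
  | A
  | P of 'I_m
  | Q of 'I_m.
Arguments A {m}.

Section VertexFinite.
Variable m : nat.

Definition vertex_code (v : vertex m) : option ('I_m + 'I_m) :=
  match v with A => None | P i => Some (inl i) | Q i => Some (inr i) end.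

Definition vertex_decode (s : option ('I_m + 'I_m)) : vertex m :=
  match s with None => A | Some (inl i) => P i | Some (inr i) => Q i end.

Lemma vertex_codeK : cancel vertex_code vertex_decode.
Proof. by case. Qed.

HB.instance Definition _ := Finite.copy (vertex m) (can_type vertex_codeK).

Lemma card_vertex : #|{: vertex m}| = (2 * m).+1.
Proof.
have decodeK : cancel vertex_decode vertex_code by case=> [[]|].
rewrite (bij_eq_card (Bijective vertex_codeK decodeK)).
by rewrite card_option card_sum card_ord mul2n addnn.
Qed.

End VertexFinite.

(* One orientation of each edge. In the last case k ranges over 0, ..., K, and
   the congruence says j = i + (2k - 1) modulo m without using the truncated
   subtraction of nat. *)
Definition arc (m K : nat) (x y : vertex m) : bool :=
  match x, y with
  | A, Q _ => true
  | P i, P j => j == i + 1 %[mod m]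
  | P i, Q j => [exists k : 'I_K.+1, j + 1 == i + 2 * k %[mod m]]
  | _, _ => false
  end.

Definition adj (m K : nat) : rel (vertex m) :=
  fun x y => arc K x y || arc K y x.

(* G is meant for odd m and H for even m, where the halvings are exact. *)
Definition G (m : nat) : rel (vertex m) := adj ((m - 3) %/ 2).
Definition H (m : nat) : rel (vertex m) := adj ((m - 2) %/ 2).

Lemma adj_sym (m K : nat) : symmetric (@adj m K).
Proof. by move=> x y; rewrite /adj orbC. Qed.

Lemma adj_irrefl (m K : nat) : 1 < m -> irreflexive (@adj m K).
Proof.
move=> m_gt1 [|i|i] //=; rewrite /adj orbb /=.
by rewrite -{1}(addn0 i) eqn_modDl mod0n modn_small.
Qed.

(* Main.v *)
Require Import Defs.
From mathcomp Require Import all_boot.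

(** Both families contain the edges joining P i to Q (i - 1) and to Q (i + 1)
    (the values k = 0 and k = 1), and these, the P-cycle and the apex already
    carry a Hamiltonian cycle, the same one for m odd and m even.

    Over the indices 0, ..., m-1, the edges P i -- Q (i +- 1) contain two
    disjoint alternating paths, Q 1, P 2, Q 3, ... (the rail, with Q at odd
    indices) and Q 0, P 1, Q 2, P 3, ... (the corail, with P at odd indices).
    Together they miss only P 0 and A.  Of their ends of index m-1, one is
    P (m-1) and the other is Q (m-1), in an order that depends on the parity of
    m; but P 0 is adjacent to both, so it joins these two ends in all cases.
    The other two ends, Q 1 and Q 0, are joined by A.  The cycle is thus

      A, Q 1, P 2, ..., (rail at m-1), P 0, (corail at m-1), ..., P 1, Q 0.

    It visits every vertex and has as many entries as there are vertices,
    hence it has no repetition. *)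

Lemma path_map_iota (T : Type) (e : rel T) (f : nat -> T) (a k : nat) :
  (forall i, a <= i < a + k -> e (f i) (f i.+1)) ->
  path e (f a) [seq f i | i <- iota a.+1 k].
Proof.
elim: k a => [|k IHk] a step //=.
rewrite step ?leqnn ?addnS ?ltnS ?leq_addr //=.
apply: IHk => i /andP[lt_ai lt_ik].
by apply: step; rewrite (ltnW lt_ai) addnS.
Qed.

Lemma last_map_iota (T : Type) (f : nat -> T) (x : T) (k : nat) :
  0 < k -> last x [seq f i | i <- iota 1 k] = f k.
Proof.
by case: k => // k _; rewrite -[X in iota _ X]addn1 iotaD map_cat last_cat add1n.
Qed.

Section Cycle.

Variables n K : nat.
Hypotheses (n_gt0 : 0 < n) (K_gt0 : 0 < K).

Local Notation V := (vertex n.+1).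
Local Notation e := (@adj n.+1 K).

Lemma adj_PQ_pred (i j : 'I_n.+1) :
  j + 1 = i %[mod n.+1] -> e (P i) (Q j).
Proof.
move=> eq_ji; rewrite /adj /= orbF; apply/existsP; exists ord0.
by rewrite muln0 addn0; apply/eqP.
Qed.

Lemma adj_PQ_succ (i j : 'I_n.+1) :
  j = i + 1 %[mod n.+1] -> e (P i) (Q j).
Proof.
move=> eq_ji; rewrite /adj /= orbF; apply/existsP.
have K1 : 1 < K.+1 by [].
exists (Ordinal K1) => /=.
by rewrite muln1 -[2]/(1 + 1) addnA eqn_modDr; apply/eqP.
Qed.

Definition rail (i : nat) : V := if odd i then Q (inord i) else P (inord i).
Definition corail (i : nat) : V := if odd i then P (inord i) else Q (inord i).

Lemma adj_PQ_inord (i : nat) :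
  i < n -> e (P (inord i)) (Q (inord i.+1)) && e (P (inord i.+1)) (Q (inord i)).
Proof.
move=> lt_in; have lt_in1 : i < n.+1 by apply: ltnW.
by rewrite adj_PQ_succ ?adj_PQ_pred // !inordK // addn1.
Qed.

Lemma rail_step (i : nat) : i < n -> e (rail i) (rail i.+1).
Proof.
move=> /adj_PQ_inord/andP[up down]; rewrite /rail /=.
by case: (odd i) => //=; rewrite adj_sym.
Qed.

Lemma corail_step (i : nat) : i < n -> e (corail i) (corail i.+1).
Proof.
move=> /adj_PQ_inord/andP[up down]; rewrite /corail /=.
by case: (odd i) => //=; rewrite adj_sym.
Qed.

(** The wrap-around edges: P 0 is adjacent to both P (m-1) and Q (m-1), which
    is what makes the parity of m irrelevant. *)
Lemma adj_P0_ends : e (P ord0) (P ord_max) && e (P ord0) (Q ord_max).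
Proof.
have wrap : n + 1 = 0 %[mod n.+1] by rewrite addn1 modnn mod0n.
apply/andP; split; last exact: (adj_PQ_pred ord0 ord_max wrap).
by apply/orP; right; apply/eqP; exact: esym wrap.
Qed.

Lemma inord_max : inord n = ord_max :> 'I_n.+1.
Proof. by apply: val_inj; rewrite /= inordK. Qed.

Lemma adj_P0_rail : e (P ord0) (rail n).
Proof.
by have /andP[PP PQ] := adj_P0_ends; rewrite /rail inord_max; case: (odd n).
Qed.

Lemma adj_P0_corail : e (P ord0) (corail n).
Proof.
by have /andP[PP PQ] := adj_P0_ends; rewrite /corail inord_max; case: (odd n).
Qed.

Definition rail_cycle : seq V :=
  A :: [seq rail i | i <- iota 1 n] ++
  P ord0 :: rev [seq corail i | i <- iota 0 n.+1].

Lemma cycle_rail_cycle : cycle e rail_cycle.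
Proof.
rewrite /rail_cycle /= rcons_cat cat_path /=; apply/and3P; split.
- rewrite -[X in iota _ X](prednK n_gt0) /= path_map_iota //.
  by move=> i /andP[_]; rewrite add1n prednK //; apply: rail_step.
- by rewrite last_map_iota // adj_sym adj_P0_rail.
(* Read backwards, the remaining path is A followed by the corail in increasing
   order and then P 0. *)
rewrite -rev_cons.
have -> : P ord0 = last A (rcons [seq corail i | i <- iota 0 n.+1] (P ord0)).
  by rewrite last_rcons.
have -> : A :: [seq corail i | i <- iota 0 n.+1] =
    belast A (rcons [seq corail i | i <- iota 0 n.+1] (P ord0)).
  by rewrite belast_rcons.
rewrite rev_path (eq_path (e' := e)); last by move=> x y; rewrite adj_sym.
rewrite rcons_path /= path_map_iota /=; last by move=> i; apply: corail_step.
by rewrite last_map_iota // adj_sym adj_P0_corail.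
Qed.

Lemma mem_rail_cycle (x : V) : x \in rail_cycle.
Proof.
have in_rail (i : 'I_n.+1) : 0 < i -> rail i \in rail_cycle.
  move=> i_gt0; rewrite inE mem_cat map_f ?orbT //.
  by rewrite mem_iota i_gt0 add1n ltn_ord.
have in_corail (i : 'I_n.+1) : corail i \in rail_cycle.
  rewrite inE mem_cat inE mem_rev (map_f corail) ?orbT //.
  by rewrite mem_iota add0n ltn_ord.
case: x => [|i|i]; first by rewrite inE eqxx.
- have [i0|i_gt0] := posnP i.
    have -> : i = ord0 by apply: val_inj.
    by rewrite inE mem_cat inE eqxx !orbT.
  have := in_corail i; have := in_rail i i_gt0.
  by rewrite /rail /corail inord_val; case: (odd i).
have := in_corail i; have := in_rail i.
rewrite /rail /corail inord_val; case i_odd: (odd i) => // rail_i _.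
exact: rail_i (odd_gt0 i_odd).
Qed.

Lemma size_rail_cycle : size rail_cycle = #|{: V}|.
Proof.
rewrite card_vertex /rail_cycle /= size_cat /= size_rev !size_map size_iota /=.
by rewrite size_map size_iota mul2n -addnn !addnS addSn.
Qed.

Lemma uniq_rail_cycle : uniq rail_cycle.
Proof.
apply: (@leq_size_uniq _ (enum {: V})); first exact: enum_uniq.
  by move=> x _; apply: mem_rail_cycle.
by rewrite -cardE size_rail_cycle.
Qed.

End Cycle.

Lemma hamiltonian_adj (m K : nat) :
  1 < m -> 0 < K -> hamiltonian (@adj m K).
Proof.
case: m => [|n] // n_gt0 K_gt0; exists (rail_cycle n); split.
- by rewrite size_rail_cycle card_vertex ltnS leq_pmulr.
- exact: cycle_rail_cycle.
- exact: uniq_rail_cycle.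
- exact: mem_rail_cycle.
Qed.

Theorem lemma4p2 (m : nat) :
  (5 <= m -> odd m -> hamiltonian (@G m)) /\
  (6 <= m -> ~~ odd m -> hamiltonian (@H m)).
Proof.
split=> m_ge _; apply: hamiltonian_adj.
- exact: leq_trans m_ge.
- by rewrite divn_gt0 // leq_subRL ?(leq_trans _ m_ge).
- exact: leq_trans m_ge.
- by rewrite divn_gt0 // leq_subRL ?(leq_trans _ m_ge).
Qed.
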